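(* Let $X$ be a reflexive smooth Banach space over $\mathbb{C}$ and let $T\in B(X)$ be self-adjoint. Then $c(T^{2n})=\mu(T^{2n})$ for all $n\in\mathbb{N}$. In addition, if $c(T)=\mu(T)$, then $c(T^{2n})=c(T)^{2n}$ for all $n\in\mathbb{N}$.
   Context: $B(X)$ is the space of bounded linear operators on $X$, $S_X=\{x\in X:\|x\|=1\}$, $X^*$ is the space of bounded linear functionals on $X$. $\mathbb{N}$ is the set of natural numbers $\{1,2,3,\dots\}$. $X$ is smooth if every $x\in S_X$ admits a unique $x^*\in S_{X^*}$ with $x^*(x)=1$. The duality mapping $J:X\to X^*$ of a smooth Banach space assigns to each $x$ the unique functional $J(x)$ with $\|J(x)\|=\|x\|$ and $J(x)(x)=\|x\|^2$. For $T\in B(X)$ the transpose $T':X^*\to X^*$ is $(T'f)(x)=f(Tx)$. $T\in B(X)$ is self-adjoint if $T'\circ J=J\circ T$. The minimum modulus is $\mu(T)=\inf\{\|Tx\|:x\in S_X\}$. The numerical range is $W(T)=\{x^*(Tx):x\in S_X,\ x^*\in S_{X^*},\ x^*(x)=1\}$ (so $W(T)=\{J(x)(Tx):x\in S_X\}$), and the Crawford number is $c(T)=\inf\{|\lambda|:\lambda\in W(T)\}$. *)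

(* Defs.v *)
From HB Require Import structures.
From mathcomp Require Import all_boot all_order all_algebra.
From mathcomp Require Import all_classical all_reals all_analysis.
From mathcomp Require Import complex.

Set Implicit Arguments.
Unset Strict Implicit.
Unset Printing Implicit Defensive.

Import Order.TTheory GRing.Theory Num.Theory.
Import numFieldNormedType.Exports.

Local Open Scope classical_set_scope.
Local Open Scope ring_scope.
Local Open Scope complex_scope.

(* Norms of normed R[i]-modules take values in R[i]; [nrm] is the norm as an
   element of R, so that real suprema and infima can be taken ([nrmE]). *)
Definition nrm {R : realType} {V : normedZmodType R[i]} (x : V) : R :=
  complex.Re `|x|.

Section RealNorm.
Context {R : realType}.
Implicit Types V : normedZmodType R[i].

Lemma nrmE V (x : V) : (nrm x)%:C = `|x|.
Proof. by rewrite /nrm RRe_real// normr_real. Qed.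

Lemma nrm_ge0 V (x : V) : 0 <= nrm x.
Proof. by rewrite -lecR nrmE normr_ge0. Qed.

Lemma nrm0 V : nrm (0 : V) = 0.
Proof. by rewrite /nrm normr0. Qed.

Lemma nrmD V (x y : V) : nrm (x + y) <= nrm x + nrm y.
Proof. by rewrite -lecR rmorphD /= !nrmE ler_normD. Qed.

Lemma nrmZ (V : normedModType R[i]) (a : R[i]) (x : V) :
  nrm (a *: x) = nrm a * nrm x.
Proof. by apply: (@complexI R); rewrite rmorphM /= !nrmE normrZ. Qed.

Lemma nrm_eq0 V (x : V) : nrm x = 0 -> x = 0.
Proof. by move=> x0; apply/normr0_eq0; rewrite -nrmE x0. Qed.

End RealNorm.

(* The normed space B(X, Y) of bounded linear operators; B(X) is [blop X X] and
   X* is [dual X]. *)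
Definition bounded_linear {R : realType} {X Y : normedModType R[i]}
    (f : X -> Y) : Prop :=
  linear f /\ exists M : R, forall x, nrm (f x) <= M * nrm x.

Definition bounded_linear_pred {R : realType} {X Y : normedModType R[i]} :
  {pred X -> Y} := fun f => `[< bounded_linear f >].

Record blop {R : realType} (X Y : normedModType R[i]) := Blop {
  blop_fun :> X -> Y;
  blop_subproof : blop_fun \in bounded_linear_pred }.

Section BoundedOperators.
Context {R : realType} {X Y : normedModType R[i]}.

HB.instance Definition _ := [isSub for @blop_fun R X Y].
HB.instance Definition _ := [Choice of blop X Y by <:].

Lemma blopP (f : blop X Y) : bounded_linear f.
Proof. exact: (asboolW (blop_subproof f)). Qed.

Lemma blop_inj (f g : blop X Y) : f =1 g -> f = g.
Proof. by move=> fg; apply: val_inj; apply: funext. Qed.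

HB.instance Definition _ (f : blop X Y) :=
  GRing.isLinear.Build R[i] X Y *:%R (blop_fun f) (proj1 (blopP f)).

Lemma bounded_linear_closed :
  submod_closed (@bounded_linear_pred R X Y).
Proof.
split.
  apply/asboolP; split => [a x y|]; first by rewrite scaler0 addr0.
  by exists 0 => x; rewrite nrm0 mul0r.
move=> a f g /asboolP[lf [M Mf]] /asboolP[lg [N Ng]]; apply/asboolP; split.
  move=> b x y; rewrite /= -[LHS]/(a *: f _ + g _) lf lg.
  rewrite -[RHS]/(b *: (a *: f x + g x) + (a *: f y + g y)).
  by rewrite !scalerDr !scalerA (mulrC a) addrACA.
exists (nrm a * M + N) => x; rewrite -[X in nrm X]/(a *: f x + g x).
apply: (le_trans (nrmD _ _)); rewrite nrmZ mulrDl lerD// -mulrA.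
by rewrite ler_wpM2l// nrm_ge0.
Qed.

HB.instance Definition _ := GRing.isSubmodClosed.Build R[i] (X -> Y)
  (@bounded_linear_pred R X Y) bounded_linear_closed.
HB.instance Definition _ := [SubChoice_isSubLmodule of blop X Y by <:].

Definition opnorm (f : blop X Y) : R :=
  sup [set nrm (f x) | x in [set x : X | nrm x <= 1]].

Lemma blopDE (f g : blop X Y) x : (f + g) x = f x + g x.
Proof. by []. Qed.

Lemma blopZE a (f : blop X Y) x : (a *: f) x = a *: f x.
Proof. by []. Qed.

Lemma opnorm_has_sup (f : blop X Y) :
  has_sup [set nrm (f x) | x in [set x : X | nrm x <= 1]].
Proof.
split; first by exists (nrm (f 0)), 0; rewrite //= nrm0.
have [_ [M Mf]] := blopP f.
exists `|M| => _ [x /= x1 <-]; apply: (le_trans (Mf x)).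
apply: (le_trans (ler_norm _)); rewrite normrM (ger0_norm (nrm_ge0 x)).
by rewrite ler_piMr.
Qed.

Lemma opnorm_ub (f : blop X Y) x : nrm x <= 1 -> nrm (f x) <= opnorm f.
Proof.
by move=> x1; apply: sup_upper_bound; [exact: opnorm_has_sup|exists x].
Qed.

Lemma opnorm_le (f : blop X Y) M :
  (forall x, nrm x <= 1 -> nrm (f x) <= M) -> opnorm f <= M.
Proof.
move=> fM; apply: ge_sup; first by have [] := opnorm_has_sup f.
by move=> _ [x /= x1 <-]; exact: fM.
Qed.

Lemma opnorm_ge0 (f : blop X Y) : 0 <= opnorm f.
Proof. by rewrite -(nrm0 Y) -(linear0 f) opnorm_ub// nrm0. Qed.

Lemma le_opnorm (f : blop X Y) x : nrm (f x) <= opnorm f * nrm x.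
Proof.
have [->|x0] := eqVneq x 0; first by rewrite linear0 !nrm0 mulr0.
have n0 : nrm x != 0 by apply: contra x0 => /eqP /nrm_eq0 ->.
have nR (r : R) : 0 <= r -> nrm (r%:C : R[i]) = r.
  by move=> r0; apply: (@complexI R); rewrite nrmE ger0_norm// lecR.
have := @opnorm_ub f ((nrm x)^-1%:C *: x).
rewrite linearZ !nrmZ nR ?invr_ge0 ?nrm_ge0// mulVf// lexx => /(_ isT).
by rewrite mulrC ler_pdivrMr// lt_neqAle eq_sym n0 nrm_ge0.
Qed.

Let bnorm (f : blop X Y) : R[i] := (opnorm f)%:C.

Let bnormD f g : bnorm (f + g) <= bnorm f + bnorm g.
Proof.
rewrite /bnorm -rmorphD lecR; apply: opnorm_le => x x1.
by rewrite blopDE (le_trans (nrmD _ _))// lerD// opnorm_ub.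
Qed.

Let bnormZ a f : bnorm (a *: f) = `|a| * bnorm f.
Proof.
rewrite /bnorm -nrmE -rmorphM; congr (_%:C); apply/eqP; rewrite eq_le.
apply/andP; split.
  apply: opnorm_le => x x1.
  by rewrite blopZE nrmZ ler_wpM2l ?nrm_ge0// opnorm_ub.
have [->|a0] := eqVneq a 0; first by rewrite nrm0 mul0r opnorm_ge0.
have n0 : 0 < nrm a.
  by rewrite lt_neqAle nrm_ge0 andbT eq_sym; apply: contra a0 => /eqP/nrm_eq0->.
rewrite mulrC -ler_pdivlMr//; apply: opnorm_le => x x1.
by rewrite ler_pdivlMr// mulrC -nrmZ -blopZE opnorm_ub.
Qed.

Let bnorm_eq0 f : bnorm f = 0 -> f = 0.
Proof.
move=> /complexI f0; apply: blop_inj => x; apply: nrm_eq0.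
by apply/eqP; rewrite eq_le nrm_ge0 andbT (le_trans (le_opnorm f x))// f0 mul0r.
Qed.

HB.instance Definition _ := Lmodule_isNormed.Build R[i] (blop X Y)
  bnormD bnormZ bnorm_eq0.

Lemma nrm_blopE (f : blop X Y) : nrm f = opnorm f.
Proof. by []. Qed.

End BoundedOperators.

Notation dual X := (blop X (GRing.regular (complex _))).

Section Composition.
Context {R : realType} {X Y Z : normedModType R[i]}.

Lemma bounded_linear_id : @id X \in bounded_linear_pred.
Proof.
by apply/asboolP; split=> [a x y|]; [|exists 1 => x; rewrite mul1r].
Qed.

Definition blop_id : blop X X := Blop bounded_linear_id.

Lemma bounded_linear_comp (f : blop Y Z) (g : blop X Y) :
  f \o g \in bounded_linear_pred.
Proof.
apply/asboolP; split=> [a x y|]; first by rewrite /= !linearP.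
exists (opnorm f * opnorm g) => x /=; rewrite -mulrA.
apply: (le_trans (le_opnorm _ _)).
by rewrite ler_wpM2l ?opnorm_ge0// le_opnorm.
Qed.

Definition blop_comp (f : blop Y Z) (g : blop X Y) : blop X Z :=
  Blop (bounded_linear_comp f g).

End Composition.

Definition blop_exp {R : realType} {X : normedModType R[i]}
    (T : blop X X) (n : nat) : blop X X :=
  iter n (blop_comp T) blop_id.

Definition transpose {R : realType} {X : normedModType R[i]}
    (T : blop X X) : dual X -> dual X := fun f => blop_comp f T.

(* A bidual element is a bounded functional on the normed space [dual X]; this
   is surjectivity of the canonical embedding of X into its bidual. *)
Definition reflexive_space {R : realType} (X : normedModType R[i]) : Prop :=
  forall F : dual (dual X), exists x : X, forall f : dual X, F f = f x.

Definition smooth {R : realType} (X : normedModType R[i]) : Prop :=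
  forall x : X, `|x| = 1 -> exists! f : dual X, `|f| = 1 /\ f x = 1.

(* [get] picks an arbitrary element of the set; in a smooth space the set is a
   singleton ([dualityP], [duality_uniq]). *)
Definition duality {R : realType} {X : normedModType R[i]} (x : X) : dual X :=
  get [set f : dual X | `|f| = `|x| /\ f x = `|x| ^+ 2].

Section Duality.
Context {R : realType} {X : normedModType R[i]}.
Hypothesis smoothX : smooth X.

Lemma duality_ex_uniq (x : X) :
  exists! f : dual X, `|f| = `|x| /\ f x = `|x| ^+ 2.
Proof.
have [->|x0] := eqVneq x 0.
  exists 0; split=> [|f []]; first by rewrite !normr0 linear0 expr0n.
  by rewrite normr0 => /normr0_eq0 ->.
have n0 : `|x| != 0 by rewrite normr_eq0.
have [|f [[f1 fx] funiq]] := smoothX (x := `|x|^-1 *: x).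
  by rewrite normrZ normfV normr_id mulVf.
exists (`|x| *: f); split.
  rewrite normrZ f1 normr_id mulr1 blopZE; split=> //.
  move: fx; rewrite linearZ /= => fx; have -> : f x = `|x|.
    by rewrite -[RHS]mulr1 -fx [`|x|^-1 *: _]/(_ * _) mulVKf.
  by rewrite expr2.
move=> g [gn gx]; rewrite (funiq (`|x|^-1 *: g)).
  by rewrite scalerA mulfV// scale1r.
split; first by rewrite normrZ normfV normr_id gn mulVf.
rewrite blopZE linearZ /= gx expr2.
by rewrite -[LHS]/(`|x|^-1 * (`|x|^-1 * (`|x| * `|x|))) mulKf// mulVf.
Qed.

Lemma dualityP (x : X) :
  `|duality x| = `|x| /\ duality x x = `|x| ^+ 2.
Proof.
have [f [fP _]] := duality_ex_uniq x.
exact: (@getI _ [set g : dual X | `|g| = `|x| /\ g x = `|x| ^+ 2] f fP).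
Qed.

Lemma duality_uniq (x : X) (f : dual X) :
  `|f| = `|x| -> f x = `|x| ^+ 2 -> f = duality x.
Proof.
move=> fn fx; have [g [_ guniq]] := duality_ex_uniq x.
by rewrite -(guniq f)//; apply: guniq; exact: dualityP.
Qed.

End Duality.

Definition self_adjoint {R : realType} {X : normedModType R[i]}
    (T : blop X X) : Prop :=
  transpose T \o duality = duality \o T.

(* [inf set0 = 0], so both quantities below are 0 on the zero space. *)
Definition minimum_modulus {R : realType} {X : normedModType R[i]}
    (T : blop X X) : R :=
  inf [set nrm (T x) | x in [set x : X | `|x| = 1]].

Definition numerical_range {R : realType} {X : normedModType R[i]}
    (T : blop X X) : set R[i] :=
  [set l | exists (x : X) (f : dual X),
     [/\ `|x| = 1, `|f| = 1, f x = 1 & l = f (T x)]].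

Definition crawford {R : realType} {X : normedModType R[i]}
    (T : blop X X) : R :=
  inf [set nrm l | l in numerical_range T].

(* Main.v *)
Require Import Defs.
From mathcomp Require Import all_boot all_order all_algebra.
From mathcomp Require Import all_classical all_reals all_analysis.
From mathcomp Require Import complex.
From mathcomp Require Import ring lra.

Import Order.TTheory GRing.Theory Num.Theory.
Import numFieldNormedType.Exports.

Local Open Scope classical_set_scope.
Local Open Scope ring_scope.
Local Open Scope complex_scope.

(** Write J for the duality mapping.  Self-adjointness of S reads
    J(x)(S y) = J(S x)(y), so J(x)(S^2 x) = J(S x)(S x) = ||S x||^2: the
    numerical range of S^2 is the set of the squares ||S x||^2 over unit
    vectors x, and c(S^2) = mu(S)^2 ([crawford_sqr]).  As powers of T are
    self-adjoint, the first claim (with S = T^n) amounts to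
    mu(S^2) = mu(S)^2, of which the inequality mu(S^2) >= mu(S)^2 is clear.

    For the other inequality let m = mu(S^2) > 0, so that m ||x|| <= ||S^2 x||
    and S is injective.  The identity above gives
    ||S z||^2 <= ||z|| ||S^2 z||, hence
    m ||S z||^2 <= m ||z|| ||S^2 z|| <= ||S^2 z||^2.
    This is the bound m ||y||^2 <= ||S y||^2 for y = S z in the range of S; it
    extends to all y by continuity once the range is dense
    ([bounded_below_sqrt]).

    Density is where reflexivity enters ([dense_range]).  If the range of S is
    not dense, a nonzero functional f vanishes on it.  By reflexivity f attains
    its norm, and by smoothness it is then a multiple of some J(x) with x
    nonzero ([functional_multiple_duality]).  So J(S x) = J(x) o S = 0 and
    S x = 0, which the injectivity of S forbids.

    For the second claim one needs mu(T^n) = mu(T)^n for every n.  It holds for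
    powers of two by squaring, and mu(T^n) >= mu(T)^n always.  If
    mu(T) > 0, a strict inequality at n would propagate to the power of two
    2^n = n + (2^n - n), by supermultiplicativity of mu; if mu(T) = 0, then
    mu(T^n) = 0 because ||T^n x|| <= ||T^(n-1)|| ||T x||
    ([minimum_modulus_exp]).

    The functionals come from a Hahn-Banach theorem in the form of Mazur and
    Orlicz ([mazur_orlicz]), proved without extending functionals from
    subspaces: a minimal sublinear functional is linear. *)

(** * Sublinear functionals and the Mazur-Orlicz theorem *)

Section HahnBanach.
Context {R : realType} {V : lmodType R[i]}.
Implicit Types (p : V -> R) (C : V -> R -> Prop) (x y a : V) (b t : R).

(** Sublinearity over the reals on a complex space, by way of the scalars t%:C.
    An inequality suffices for homogeneity: applying it to t^-1 gives equality,
    see [sublinearZ]. *)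
Definition sublinear p : Prop :=
  (forall x y, p (x + y) <= p x + p y) /\
  (forall t x, 0 < t -> p (t%:C *: x) <= t * p x).

Lemma sublinear0 p : sublinear p -> p 0 = 0.
Proof.
move=> [pD pZ].
have := pD 0 0; rewrite addr0 => h1.
by have := pZ 2^-1 0 ltac:(lra); rewrite scaler0; lra.
Qed.

Lemma sublinearN_ge p x : sublinear p -> - p (- x) <= p x.
Proof.
move=> ps; have := sublinear0 p ps; have [pD _] := ps.
by have := pD x (- x); rewrite subrr; lra.
Qed.

Lemma sublinearZ p t x : sublinear p -> 0 <= t -> p (t%:C *: x) = t * p x.
Proof.
move=> ps; rewrite le_eqVlt => /predU1P[<-|t0].
  by rewrite scale0r mul0r sublinear0.
have [_ pZ] := ps; apply/eqP; rewrite eq_le pZ//= mulrC -ler_pdivlMr// mulrC.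
apply: le_trans (pZ t^-1 _ _); last by rewrite invr_gt0.
rewrite scalerA -rmorphM/= mulVf ?scale1r// gt_eqF//.
Qed.

(** C a b stands for the requirement f a >= b on a linear functional f <= p.
    The requirements that a given f meets form a convex cone, and satisfy
    b <= p a. *)
Definition dominated_cone p C : Prop :=
  [/\ C 0 0,
      forall a b a' b', C a b -> C a' b' -> C (a + a') (b + b'),
      forall t a b, 0 < t -> C a b -> C (t%:C *: a) (t * b) &
      forall a b, C a b -> b <= p a].

(** The requirements C can be built into the sublinear bound: any linear
    f <= p with f a >= b satisfies f x = f (x + a) - f a <= p (x + a) - b, and
    the infimum of these bounds over C is still sublinear. *)
Lemma cone_lower p C : sublinear p -> dominated_cone p C ->
  exists q, [/\ sublinear q, forall x, q x <= p x &
                forall a b, C a b -> q (- a) <= - b].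
Proof.
move=> ps [C0 CD CZ Cp]; have [pD pZ] := ps.
pose E x := [set r | exists a b, C a b /\ r = p (x + a) - b].
have Elb x : has_lbound (E x).
  exists (- p (- x)) => _ [a [b [Cab ->]]].
  have := pD (x + a) (- x); rewrite [x + a]addrC addrK => h.
  by have := Cp _ _ Cab; lra.
have Ele x a b : C a b -> inf (E x) <= p (x + a) - b.
  by move=> Cab; apply: ge_inf => //; exists a, b.
have Ege x r : (forall a b, C a b -> r <= p (x + a) - b) -> r <= inf (E x).
  move=> h; apply: lb_le_inf; first by exists (p (x + 0) - 0), 0, 0.
  by move=> _ [a [b [Cab ->]]]; exact: h.
exists (fun x => inf (E x)); split.
- split=> [x y|t x t0].
    rewrite -lerBlDr; apply: (Ege) => a b Cab.
    rewrite lerBlDr -lerBlDl; apply: (Ege) => a' b' Cab'.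
    rewrite lerBlDl; apply: le_trans (Ele _ _ _ (CD _ _ _ _ Cab Cab')) _.
    by rewrite addrACA; have := pD (x + a) (y + a'); lra.
  rewrite mulrC -ler_pdivrMr//; apply: (Ege) => a b Cab.
  rewrite ler_pdivrMr// mulrC mulrBr.
  apply: le_trans (Ele _ _ _ (CZ _ _ _ t0 Cab)) _.
  by rewrite -scalerDr lerD2r pZ.
- by move=> x; have := Ele x _ _ C0; rewrite addr0 subr0.
- by move=> a b /(Ele (- a)); rewrite addNr sublinear0// sub0r.
Qed.

(** Zorn's lemma for the reverse pointwise order.  The pointwise infimum of a
    chain is finite, since sublinear functionals below p are bounded below at
    x by - p (- x), and it is subadditive because two members of a chain can be
    replaced by the smaller of them. *)
Lemma minimal_sublinear p : sublinear p ->
  exists q, [/\ sublinear q, forall x, q x <= p x &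
    forall q', sublinear q' -> (forall x, q' x <= q x) -> forall x, q' x = q x].
Proof.
move=> ps.
pose U := {q : V -> R | sublinear q /\ forall x, q x <= p x}.
pose ge (q q' : U) := `[< forall x, sval q' x <= sval q x >].
have [|||A Atot|[q [qs qp]] qmin] := @Zorn U ge.
- by move=> q; apply/asboolP.
- move=> q r s /asboolP qr /asboolP rs; apply/asboolP => x.
  exact: le_trans (rs x) (qr x).
- move=> [q qP] [r rP] /asboolP/= qr /asboolP/= rq.
  have qrE : q = r by apply/funext => x; apply/eqP; rewrite eq_le qr rq.
  by move: qP; rewrite qrE => qP; congr exist; exact: Prop_irrelevance.
- have [[q0 Aq0]|A0] := pselect (A !=set0); last first.
    exists (exist _ p (conj ps (fun x => lexx (p x)))) => q Aq.
    by case: A0; exists q.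
  pose E x := [set sval q x | q in A].
  have Elb x : has_lbound (E x).
    exists (- p (- x)) => _ [q Aq <-]; have [qs qp] := svalP q.
    by have := sublinearN_ge _ x qs; have := qp (- x); lra.
  have Ele q x : A q -> inf (E x) <= sval q x.
    by move=> Aq; apply: ge_inf => //; exists q.
  have Ege x r : (forall q, A q -> r <= sval q x) -> r <= inf (E x).
    move=> h; apply: lb_le_inf; first by exists (sval q0 x), q0.
    by move=> _ [q Aq <-]; exact: h.
  have ms : sublinear (fun x => inf (E x)).
    split=> [x y|t x t0].
      rewrite -lerBlDr; apply: (Ege) => q Aq.
      rewrite lerBlDr -lerBlDl; apply: (Ege) => r Ar; rewrite lerBlDl.
      have [[qD _] _] := svalP q; have [[rD _] _] := svalP r.
      have [/asboolP qr|/asboolP rq] := Atot q r Aq Ar.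
        apply: le_trans (Ele r _ Ar) _; apply: le_trans (rD _ _) _.
        by have := qr x; lra.
      apply: le_trans (Ele q _ Aq) _; apply: le_trans (qD _ _) _.
      by have := rq y; lra.
    rewrite mulrC -ler_pdivrMr//; apply: (Ege) => q Aq.
    rewrite ler_pdivrMr// mulrC; apply: le_trans (Ele q _ Aq) _.
    by have [[_ qZ] _] := svalP q; exact: qZ.
  have mp x : inf (E x) <= p x.
    by apply: le_trans (Ele q0 x Aq0) _; have [_ ->] := svalP q0.
  exists (exist _ (fun x => inf (E x)) (conj ms mp)) => q Aq.
  by apply/asboolP => x; exact: Ele.
exists q; split=> // q' q's q'q x.
have q'p y : q' y <= p y by exact: le_trans (q'q y) (qp y).
have := qmin (exist _ q' (conj q's q'p)) => /(_ _)/(congr1 sval)/= -> //.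
exact/asboolP.
Qed.

(** A sublinear f that is minimal below the bound of [cone_lower] is linear.
    Indeed, lowering f along the ray through x, with the requirement that the
    value at x stays f x, cannot change f, whence f (- x) <= - f x.  So f is
    odd, and an odd sublinear functional is linear. *)
Lemma mazur_orlicz p C : sublinear p -> dominated_cone p C ->
  exists f : V -> R,
    [/\ forall x y, f (x + y) = f x + f y,
        forall t x, f (t%:C *: x) = t * f x,
        forall x, f x <= p x &
        forall a b, C a b -> b <= f a].
Proof.
move=> ps Cp; have [p1 [p1s p1p p1C]] := cone_lower _ _ ps Cp.
have [f [fs fp1 fmin]] := minimal_sublinear _ p1s.
have [fD fZ] := fs.
have fN x : f (- x) = - f x.
  apply/eqP; rewrite eq_le; apply/andP; split; last first.
    by have := sublinearN_ge f x fs; lra.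
  pose D a b := exists t, [/\ 0 <= t, a = t%:C *: x & b = t * f x].
  have [|q [qs qf qD]] := cone_lower f D fs.
    split.
    - by exists 0; rewrite scale0r mul0r.
    - move=> _ _ _ _ [t [t0 -> ->]] [s [s0 -> ->]]; exists (t + s).
      by rewrite addr_ge0// rmorphD/= scalerDl mulrDl.
    - move=> t _ _ t0 [s [s0 -> ->]]; exists (t * s).
      by rewrite mulr_ge0// ?(ltW t0)// rmorphM/= scalerA mulrA.
    - by move=> _ _ [t [t0 -> ->]]; rewrite sublinearZ.
  rewrite -(fmin q)//; apply: qD; exists 1.
  by rewrite ler01 scale1r mul1r.
exists f; split.
- move=> x y; apply/eqP; rewrite eq_le fD/=.
  by have := fD (- x) (- y); rewrite -opprD !fN; lra.
- move=> t x; have [t0|t0] := leP 0 t; first exact: sublinearZ.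
  rewrite -[t]opprK rmorphN/= scaleNr fN sublinearZ ?mulNr//.
  by rewrite oppr_ge0 ltW.
- by move=> x; apply: le_trans (fp1 x) (p1p x).
- by move=> a b /p1C; have := fp1 (- a); rewrite fN; lra.
Qed.

End HahnBanach.

(** * Complex functionals *)

Section ComplexFunctionals.
Context {R : realType}.

(** The complex functional with real part h is h x - i h (i x).  Its modulus is
    controlled by h alone: |f x|^2 = f ((f x)^* x) is real, hence equal to
    h ((f x)^* x) <= |f x| ||x||. *)
Lemma complexification (V : normedModType R[i]) (h : V -> R) :
  (forall x y, h (x + y) = h x + h y) ->
  (forall (t : R) x, h (t%:C *: x) = t * h x) ->
  (forall x, h x <= nrm x) ->
  exists f : dual V, nrm f <= 1 /\ forall x, complex.Re (f x) = h x.
Proof.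
move=> hD hZ hle.
pose f (x : V) : R[i]^o := h x +i* (- h ('i *: x)).
have hZc (s t : R) x : h ((s +i* t) *: x) = s * h x + t * h ('i *: x).
  have -> : (s +i* t) *: x = s%:C *: x + t%:C *: ('i *: x).
    by rewrite scalerA -scalerDl; congr (_ *: _); simpc.
  by rewrite hD !hZ.
have flin : linear f.
  move=> [s t] x y.
  have hi : h ('i *: ((s +i* t) *: x)) = - t * h x + s * h ('i *: x).
    by rewrite scalerA -hZc; congr (h (_ *: _)); simpc.
  apply/eqP; rewrite eq_complex /f scalerDr !hD hi hZc.
  by apply/andP; split; apply/eqP => /=; ring.
have fle x : nrm (f x) <= nrm x.
  have [->|fx0] := eqVneq (nrm (f x)) 0; first exact: nrm_ge0.
  have fx_gt0 : 0 < nrm (f x) by rewrite lt_neqAle eq_sym fx0 nrm_ge0.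
  rewrite -(ler_pM2l fx_gt0).
  have := hle ((f x)^*%C *: x); rewrite nrmZ.
  have -> : nrm ((f x)^*%C : R[i]) = nrm (f x) by rewrite /nrm normcJ.
  suff -> : h ((f x)^*%C *: x) = nrm (f x) * nrm (f x) by [].
  have := add_Re2_Im2 (f x); rewrite -nrmE -rmorphXn/= => /complexI.
  by rewrite -expr2 => <-; rewrite hZc; ring.
have fb : f \in bounded_linear_pred.
  by apply/asboolP; split=> //; exists 1 => x; rewrite mul1r.
exists (Blop fb); split=> //.
by rewrite nrm_blopE; apply: opnorm_le => x x1; exact: le_trans (fle x) x1.
Qed.

(** For t > 0, the distance hypothesis scales to t d <= ||t x0 + g z||, so the
    pairs (t x0 + g z, t d) with t >= 0 form a dominated cone.  A real linear h
    that meets it is nonnegative on the range of g, a subspace, hence zero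
    there. *)
Lemma separation {V : normedModType R[i]} {W : lmodType R[i]}
    (g : {linear W -> V}) (x0 : V) (d : R) :
  0 <= d -> (forall z, d <= nrm (x0 - g z)) ->
  exists f : dual V,
    [/\ nrm f <= 1, forall z, f (g z) = 0 & d <= complex.Re (f x0)].
Proof.
move=> d0 dg.
have gZ a w : g (a *: w) = a *: g w by exact: linearZ.
pose C (a : V) (b : R) :=
  exists t z, [/\ 0 <= t, a = t%:C *: x0 + g z & b = t * d].
have nrmR (t : R) : 0 <= t -> nrm (t%:C : R[i]) = t.
  by move=> t0; apply: (@complexI R); rewrite nrmE ger0_norm// lecR.
have ns : sublinear (@nrm R V).
  by split=> [x y|t x t0]; [exact: nrmD|rewrite nrmZ nrmR// ltW].
have [|h [hD hZ hle hC]] := mazur_orlicz nrm C ns.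
  split.
  - by exists 0, 0; rewrite scale0r linear0 addr0 mul0r.
  - move=> _ _ _ _ [t [z [t0 -> ->]]] [s [w [s0 -> ->]]].
    exists (t + s), (z + w).
    by rewrite addr_ge0// rmorphD/= scalerDl linearD mulrDl addrACA.
  - move=> t _ _ t0 [s [w [s0 -> ->]]]; exists (t * s), (t%:C *: w).
    split; [by rewrite mulr_ge0// ltW| |exact: mulrA].
    by rewrite rmorphM/= -scalerA scalerDr gZ.
  - move=> _ _ [t [z [t0 -> ->]]]; move: t0.
    rewrite le_eqVlt => /predU1P[<-|t0].
      by rewrite mul0r nrm_ge0.
    have -> : t%:C *: x0 + g z = t%:C *: (x0 - g (- (t^-1)%:C *: z)).
      rewrite gZ scalerBr scalerA mulrN -rmorphM/= mulfV ?gt_eqF//.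
      by rewrite scaleNr scale1r opprK.
    by rewrite nrmZ nrmR ?(ltW t0)// ler_pM2l.
have hg z : h (g z) = 0.
  have hg0 w : 0 <= h (g w).
    by apply: hC; exists 0, w; rewrite scale0r add0r mul0r.
  have := hZ (-1) (g z); rewrite rmorphN/= scaleN1r -linearN => hN.
  by have := hg0 z; have := hg0 (- z); lra.
have [f [f1 fh]] := complexification V h hD hZ hle.
exists f; split=> //.
  move=> z; apply/eqP; rewrite eq_complex fh hg eqxx/=.
  have := fh (g ('i *: z)); rewrite hg gZ linearZ/=.
  by case: (f (g z)) => a b /=; rewrite mul0r mul1r sub0r => /eqP;
    rewrite oppr_eq0.
by rewrite fh; apply: hC; exists 1, 0; rewrite scale1r linear0 addr0 mul1r.
Qed.

(** Separation of v from the zero subspace.  The functional obtained satisfies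
    Re (f v) >= ||v|| >= |f v|, which leaves no room for an imaginary part. *)
Lemma norming_functional {V : normedModType R[i]} (v : V) :
  exists f : dual V, nrm f <= 1 /\ f v = `|v|.
Proof.
have [|f [f1 _ fv]] := separation (0 : blop V V) v (nrm v) (nrm_ge0 v).
  by move=> z; rewrite subr0.
exists f; split=> //.
have fle : nrm (f v) <= nrm v.
  apply: le_trans (le_opnorm f v) _; rewrite -nrm_blopE.
  by rewrite ler_piMl// nrm_ge0.
rewrite -nrmE; have := add_Re2_Im2 (f v).
rewrite -nrmE -rmorphXn/= => /complexI.
move: fv fle (nrm_ge0 (f v)); case: (f v) => a b /= va fle fv0 normE.
have b0 : b = 0.
  by apply/eqP; rewrite -sqrf_eq0; apply/eqP; have := sqr_ge0 b; nra.
congr (_ +i* _) => //; apply/eqP; rewrite eq_le va andbT.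
apply: le_trans fle; rewrite -(@ler_pXn2r _ 2)// ?nnegrE//; last first.
  exact: le_trans (nrm_ge0 v) va.
by rewrite -normE b0 expr0n addr0.
Qed.

End ComplexFunctionals.

(** * Self-adjoint operators *)

Section SelfAdjoint.
Context {R : realType} {X : normedModType R[i]}.
Implicit Types (S : blop X X) (x y z : X) (m e : R).

Lemma norm_eq1 x : `|x| = 1 <-> nrm x = 1.
Proof. by rewrite -nrmE; split=> [|->//]; exact: complexI. Qed.

Section Smooth.
Hypothesis smoothX : smooth X.

Lemma dualityE x : duality x x = (nrm x ^+ 2)%:C.
Proof. by have [_ ->] := dualityP smoothX x; rewrite -nrmE -rmorphXn. Qed.

Lemma nrm_duality x : nrm (duality x) = nrm x.
Proof. by have [h _] := dualityP smoothX x; rewrite /nrm h. Qed.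

(** A norming functional of f in the bidual is evaluation at some x, by
    reflexivity, so f attains its norm at x.  That ||x|| <= 1 is seen by
    evaluating at J(x) itself, as J(x)(x) = ||x||^2; smoothness identifies f,
    once normalised, with J(x). *)
Lemma functional_multiple_duality (f : dual X) : reflexive_space X -> f != 0 ->
  exists2 x : X, x != 0 & exists c : R[i], f = c *: duality x.
Proof.
move=> reflX f0; have nf0 : `|f| != 0 by rewrite normr_eq0.
pose g := `|f|^-1 *: f.
have g1 : `|g| = 1 by rewrite normrZ normfV normr_id mulVf.
have [F [F1 Fg]] := norming_functional g.
have [x Fx] := reflX F.
have gx : g x = 1 by rewrite -Fx Fg.
have x1 : `|x| = 1.
  apply/norm_eq1/eqP; rewrite eq_le; apply/andP; split.
    have [->|x0] := eqVneq (nrm x) 0; first exact: ler01.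
    have x_gt0 : 0 < nrm x by rewrite lt_neqAle eq_sym x0 nrm_ge0.
    rewrite -(ler_pM2l x_gt0) mulr1 -expr2.
    have := le_opnorm F (duality x); rewrite -nrm_blopE Fx dualityE nrm_duality.
    rewrite /nrm ger0_norm ?lecR ?sqr_ge0//= -/(nrm x) => /le_trans; apply.
    by rewrite ler_piMl// nrm_ge0.
  have := le_opnorm g x; rewrite -nrm_blopE gx /nrm g1 normr1 /=.
  by rewrite mul1r.
exists x; first by rewrite -normr_eq0 x1 oner_eq0.
exists `|f|; rewrite -(@duality_uniq _ _ smoothX x g) ?x1 ?expr1n//.
by rewrite scalerA mulfV// scale1r.
Qed.

Lemma self_adjointE S x y : self_adjoint S -> duality x (S y) = duality (S x) y.
Proof. by move=> sS; have /(congr1 (fun J : X -> dual X => J x y)) := sS. Qed.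

(** This makes W(S^2) consist of squares of norms. *)
Lemma duality_sqr S x : self_adjoint S ->
  duality x (S (S x)) = (nrm (S x) ^+ 2)%:C.
Proof. by move=> sS; rewrite self_adjointE// dualityE. Qed.

Lemma nrm_sqr_le S x : self_adjoint S ->
  nrm (S x) ^+ 2 <= nrm x * nrm (S (S x)).
Proof.
move=> sS; have := le_opnorm (duality x) (S (S x)).
rewrite duality_sqr// -nrm_blopE nrm_duality; apply: le_trans.
by rewrite /nrm ger0_norm ?lecR ?sqr_ge0.
Qed.

(** A functional f that vanishes on the range of S is c J(x) with x nonzero, so
    J(S x) = J(x) o S = 0 when c is nonzero, and S x = 0 against injectivity. *)
Lemma dense_range S : reflexive_space X -> self_adjoint S ->
  (forall x, S x = 0 -> x = 0) ->
  forall y e, 0 < e -> exists z, nrm (y - S z) < e.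
Proof.
move=> reflX sS Sinj y e e0; apply: contrapT => /forallNP nz.
have [|f [_ fS fy]] := separation S y e (ltW e0).
  by move=> z; rewrite leNgt; apply/negP; exact: nz.
have f0 : f != 0.
  by apply: contraTneq fy => ->; rewrite -ltNge.
have [x x0 [c fE]] := functional_multiple_duality f reflX f0.
have c0 : c != 0 by apply: contraNneq f0 => c0; rewrite fE c0 scale0r.
have JSx0 : duality (S x) = 0.
  apply: blop_inj => z; rewrite -self_adjointE//; apply/eqP.
  by rewrite -(mulrI_eq0 _ (mulfI c0)) -(fS z) fE.
move/eqP: x0; apply; apply: Sinj; apply: nrm_eq0.
by rewrite -nrm_duality JSx0 nrm0.
Qed.

(** The bound for y = S z follows from ||S z||^2 <= ||z|| ||S^2 z|| by absorbing
    ||z|| into ||S^2 z|| / m; density of the range and continuity of S give it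
    for all y. *)
Lemma bounded_below_sqrt S m : reflexive_space X -> self_adjoint S ->
  (forall x, m * nrm x <= nrm (S (S x))) ->
  forall y, Num.sqrt m * nrm y <= nrm (S y).
Proof.
move=> reflX sS Sm y; have [m_le0|m_gt0] := leP m 0.
  by rewrite ler0_sqrtr// mul0r nrm_ge0.
have Sinj x : S x = 0 -> x = 0.
  move=> Sx0; apply: nrm_eq0; apply/eqP; rewrite eq_le nrm_ge0 andbT.
  by rewrite -(pmulr_rle0 _ m_gt0); have := Sm x; rewrite Sx0 linear0 nrm0.
have range_bound z : Num.sqrt m * nrm (S z) <= nrm (S (S z)).
  rewrite -(@ler_pXn2r _ 2)// ?nnegrE ?mulr_ge0 ?sqrtr_ge0 ?nrm_ge0//.
  rewrite exprMn sqr_sqrtr ?(ltW m_gt0)// expr2.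
  have := nrm_sqr_le S z sS; have := Sm z; have := nrm_ge0 (S (S z)).
  by nra.
(* K adds the Lipschitz constants of the two sides of the inequality, as
   functions of y, and 1 to be positive. *)
apply/ler_addgt0Pr => e e0.
pose K := Num.sqrt m + opnorm S + 1.
have K0 : 0 < K by have := sqrtr_ge0 m; have := opnorm_ge0 S; rewrite /K; lra.
have [z yz] := dense_range S reflX sS Sinj y (e / K) (divr_gt0 e0 K0).
have eK : nrm (y - S z) * K <= e by rewrite -ler_pdivlMr// ltW.
have h1 : nrm y <= nrm (y - S z) + nrm (S z).
  by rewrite -{1}(subrK (S z) y) nrmD.
have h2 : nrm (S (S z)) <= nrm (S y) + opnorm S * nrm (y - S z).
  have -> : S (S z) = S y + S (S z - y) by rewrite linearB addrC subrK.
  apply: le_trans (nrmD _ _) _; rewrite lerD2l.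
  have -> : nrm (y - S z) = nrm (S z - y) by rewrite /nrm distrC.
  exact: le_opnorm.
have h3 := range_bound z; have h4 := ler_wpM2l (sqrtr_ge0 m) h1.
have h5 := nrm_ge0 (y - S z); move: eK; rewrite /K; nra.
Qed.

End Smooth.
End SelfAdjoint.

(** * Minimum modulus and Crawford number *)

Section Moduli.
Context {R : realType} {X : normedModType R[i]}.
Implicit Types (S T A B : blop X X) (x y z : X) (n : nat) (m : R).

Lemma inf_ge0 (E : set R) : (forall r, E r -> 0 <= r) -> 0 <= inf E.
Proof.
move=> E0; have [->|/set0P En0] := eqVneq E set0; first by rewrite inf0.
exact: lb_le_inf.
Qed.

Lemma minimum_modulus_le S x : minimum_modulus S * nrm x <= nrm (S x).
Proof.
have [->|x0] := eqVneq x 0; first by rewrite linear0 nrm0 mulr0.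
have nx0 : `|x| != 0 by rewrite normr_eq0.
have nx_gt0 : 0 < nrm x.
  by rewrite lt_neqAle nrm_ge0 andbT eq_sym; apply: contra x0 => /eqP/nrm_eq0->.
rewrite -ler_pdivlMr//; apply: ge_inf.
  by exists 0 => _ [z _ <-]; exact: nrm_ge0.
exists (`|x|^-1 *: x) => /=; first by rewrite normrZ normfV normr_id mulVf.
rewrite linearZ nrmZ mulrC; congr (_ * _).
by rewrite -nrmE -fmorphV /nrm ger0_norm// lecR invr_ge0 nrm_ge0.
Qed.

Lemma minimum_modulus_ge0 S : 0 <= minimum_modulus S.
Proof. by apply: inf_ge0 => _ [x _ <-]; exact: nrm_ge0. Qed.

Lemma le_minimum_modulus S m : (exists x : X, `|x| = 1) ->
  (forall x, m * nrm x <= nrm (S x)) -> m <= minimum_modulus S.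
Proof.
move=> [x x1] Sm; apply: lb_le_inf; first by exists (nrm (S x)), x.
by move=> _ [y /norm_eq1 y1 <-]; rewrite -[m]mulr1 -y1.
Qed.

(** Covers the zero space, where the infimum is over the empty set. *)
Lemma minimum_modulus_trivial S :
  ~ (exists x : X, `|x| = 1) -> minimum_modulus S = 0.
Proof.
move=> X0; rewrite /minimum_modulus (_ : [set _ | _ in _] = set0) ?inf0//.
by rewrite -subset0 => r [x x1 _]; case: X0; exists x.
Qed.

Lemma minimum_modulus_comp A B :
  minimum_modulus A * minimum_modulus B <= minimum_modulus (blop_comp A B).
Proof.
have [X1|X0] := pselect (exists x : X, `|x| = 1); last first.
  by rewrite !minimum_modulus_trivial// mul0r.
apply: le_minimum_modulus => // x; apply: le_trans (minimum_modulus_le A (B x)).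
by rewrite -mulrA ler_wpM2l ?minimum_modulus_ge0// minimum_modulus_le.
Qed.

Lemma blop_expE T n x : blop_exp T n x = iter n T x.
Proof. by elim: n => //= n <-. Qed.

Lemma blop_expD T (m n : nat) :
  blop_exp T (m + n) = blop_comp (blop_exp T m) (blop_exp T n).
Proof. by apply: blop_inj => x; rewrite /= !blop_expE iterD. Qed.

Lemma self_adjoint_exp T n : self_adjoint T -> self_adjoint (blop_exp T n).
Proof.
move=> sT; apply/funext => x; apply: blop_inj => y /=; rewrite !blop_expE.
elim: n x y => //= n IHn x y.
by rewrite self_adjointE// IHn -iterSr.
Qed.

Hypotheses (reflX : reflexive_space X) (smoothX : smooth X).

(** The square root of mu(S^2) is a lower bound of S by [bounded_below_sqrt]. *)
Lemma minimum_modulus_sqr S : self_adjoint S ->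
  minimum_modulus (blop_comp S S) = minimum_modulus S ^+ 2.
Proof.
move=> sS; apply/eqP; rewrite eq_le expr2 minimum_modulus_comp andbT.
have [X1|X0] := pselect (exists x : X, `|x| = 1); last first.
  by rewrite !minimum_modulus_trivial// mul0r.
rewrite -expr2 -[leLHS]sqr_sqrtr ?minimum_modulus_ge0//.
rewrite ler_pXn2r// ?nnegrE ?sqrtr_ge0 ?minimum_modulus_ge0//.
apply: le_minimum_modulus => //.
apply: (bounded_below_sqrt smoothX) => // x.
exact: (minimum_modulus_le (blop_comp S S)).
Qed.

(** By smoothness, the functionals in the definition of the numerical range are
    the J(x), so that c(S^2) is the infimum of ||S x||^2 over unit vectors. *)
Lemma crawford_sqr S : self_adjoint S ->
  crawford (blop_comp S S) = minimum_modulus S ^+ 2.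
Proof.
move=> sS.
have crawfordE : crawford (blop_comp S S) =
    inf [set nrm (S x) ^+ 2 | x in [set x : X | `|x| = 1]].
  congr inf; apply/seteqP; split=> [_ [_ [x [f [x1 f1 fx ->]]] <-]|_ [x x1 <-]].
    exists x => //=; rewrite (_ : f = duality x) ?duality_sqr//.
      by rewrite /nrm ger0_norm// lecR sqr_ge0.
    by apply: duality_uniq; rewrite ?x1 ?expr1n.
  exists (duality x (S (S x))).
    exists x, (duality x); have [-> ->] := dualityP smoothX x.
    by rewrite x1 expr1n.
  by rewrite duality_sqr// /nrm ger0_norm// lecR sqr_ge0.
have [[x0 x01]|X0] := pselect (exists x : X, `|x| = 1); last first.
  rewrite minimum_modulus_trivial// expr0n crawfordE.
  rewrite (_ : [set _ | _ in _] = set0) ?inf0//.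
  by rewrite -subset0 => r [x x1 _]; case: X0; exists x.
rewrite crawfordE; apply/eqP; rewrite eq_le; apply/andP; split.
  set c := inf _.
  have c0 : 0 <= c by apply: inf_ge0 => _ [x _ <-]; exact: sqr_ge0.
  rewrite -[c]sqr_sqrtr// ler_pXn2r// ?nnegrE ?sqrtr_ge0 ?minimum_modulus_ge0//.
  apply: lb_le_inf; first by exists (nrm (S x0)), x0.
  move=> _ [x x1 <-]; rewrite -(@ler_pXn2r _ 2)// ?nnegrE ?sqrtr_ge0 ?nrm_ge0//.
  rewrite sqr_sqrtr//; apply: ge_inf; last by exists x.
  by exists 0 => _ [y _ <-]; exact: sqr_ge0.
apply: lb_le_inf; first by exists (nrm (S x0) ^+ 2), x0.
move=> _ [x /norm_eq1 x1 <-].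
rewrite ler_pXn2r// ?nnegrE ?minimum_modulus_ge0 ?nrm_ge0//.
by have := minimum_modulus_le S x; rewrite x1 mulr1.
Qed.

Lemma minimum_modulus_exp_ge T n : (0 < n)%N ->
  minimum_modulus T ^+ n <= minimum_modulus (blop_exp T n).
Proof.
elim: n => // -[_ _|n IHn _].
  by rewrite expr1 (_ : blop_exp T 1 = T)//; apply: blop_inj.
rewrite exprS; apply: le_trans (minimum_modulus_comp T (blop_exp T n.+1)).
by rewrite ler_wpM2l ?minimum_modulus_ge0// IHn.
Qed.

Lemma minimum_modulus_exp2 T k : self_adjoint T ->
  minimum_modulus (blop_exp T (2 ^ k)) = minimum_modulus T ^+ (2 ^ k).
Proof.
move=> sT; elim: k => [|k IHk].
  by rewrite expr1 (_ : blop_exp T _ = T)//; apply: blop_inj.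
rewrite expnS mul2n -addnn blop_expD minimum_modulus_sqr; last first.
  exact: self_adjoint_exp.
by rewrite IHk addnn -muln2 exprM.
Qed.

(** From ||T^n x|| <= ||T^(n-1)|| ||T x||, a positive lower bound for T^n yields
    one for T. *)
Lemma minimum_modulus_exp_eq0 T n : (0 < n)%N ->
  minimum_modulus T = 0 -> minimum_modulus (blop_exp T n) = 0.
Proof.
move=> n0 T0; apply/eqP; rewrite eq_le minimum_modulus_ge0 andbT.
have [X1|X0] := pselect (exists x : X, `|x| = 1); last first.
  by rewrite minimum_modulus_trivial.
set m := minimum_modulus _; pose K := opnorm (blop_exp T n.-1) + 1.
have K0 : 0 < K by rewrite ltr_pwDr// opnorm_ge0.
suff : m / K <= 0 by rewrite pmulr_lle0// invr_gt0.
rewrite -T0; apply: le_minimum_modulus => // x.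
rewrite mulrAC ler_pdivrMr//; apply: le_trans (minimum_modulus_le _ x) _.
rewrite -{1}(prednK n0) blop_expE iterSr -blop_expE.
apply: le_trans (le_opnorm _ _) _; rewrite mulrC ler_wpM2l ?nrm_ge0//.
by rewrite lerDl.
Qed.

(** Completing n to a power of two, mu(T)^(2^n) = mu(T^(2^n)) is at least
    mu(T^n) mu(T)^(2^n - n); cancelling mu(T)^(2^n - n), when it is
    positive, bounds mu(T^n) above. *)
Lemma minimum_modulus_exp T n : self_adjoint T -> (0 < n)%N ->
  minimum_modulus (blop_exp T n) = minimum_modulus T ^+ n.
Proof.
move=> sT n0; apply/eqP; rewrite eq_le minimum_modulus_exp_ge// andbT.
have [T0|Tn0] := eqVneq (minimum_modulus T) 0.
  by rewrite minimum_modulus_exp_eq0// exprn_ge0// minimum_modulus_ge0.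
have T_gt0 : 0 < minimum_modulus T.
  by rewrite lt_neqAle eq_sym Tn0 minimum_modulus_ge0.
have n2 : (n < 2 ^ n)%N by exact: ltn_expl.
have := minimum_modulus_comp (blop_exp T n) (blop_exp T (2 ^ n - n)).
rewrite -blop_expD subnKC ?(ltnW n2)// minimum_modulus_exp2//.
rewrite -{2}(subnKC (ltnW n2)) exprD => le_prod.
rewrite -(ler_pM2r (exprn_gt0 (2 ^ n - n) T_gt0)); apply: le_trans le_prod.
by rewrite ler_wpM2l ?minimum_modulus_ge0// minimum_modulus_exp_ge// subn_gt0.
Qed.

End Moduli.

Theorem proposition10 (R : realType) (X : completeNormedModType R[i])
    (T : blop X X) :
  reflexive_space X -> smooth X -> self_adjoint T ->
  (forall n : nat, (0 < n)%N ->
     crawford (blop_exp T (2 * n)) = minimum_modulus (blop_exp T (2 * n))) /\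
  (crawford T = minimum_modulus T ->
   forall n : nat, (0 < n)%N ->
     crawford (blop_exp T (2 * n)) = crawford T ^+ (2 * n)).
Proof.
move=> reflX smoothX sT.
have crawfordE n : (0 < n)%N ->
    crawford (blop_exp T (2 * n)) = minimum_modulus (blop_exp T (2 * n)).
  move=> n0; have sTn := self_adjoint_exp T n sT.
  by rewrite mul2n -addnn blop_expD crawford_sqr// minimum_modulus_sqr.
split=> // -> n n0.
by rewrite crawfordE// minimum_modulus_exp// muln_gt0.
Qed.
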